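(* Let $p\ge3$, $X\sim N_p(\theta,D)$ with $D=\operatorname{diag}(d_1,\ldots,d_p)$, $d_j>0$, and $\Gamma=\operatorname{diag}(\gamma_1,\ldots,\gamma_p)$, $\gamma_j\ge0$. Let $d_j^*=d_j^2/(d_j+\gamma_j)$ with indices sorted so that $d_1^*\ge\cdots\ge d_p^*$. Let $A^\dagger=\operatorname{diag}(a_1^\dagger,\ldots,a_p^\dagger)$ be the unique maximizer of $c^*(D,A)=\sum_j d_ja_j-2\max_j d_ja_j$ over $a_j\ge0$ with $\sum_j(d_j+\gamma_j)a_j^2=\sum_j d_j^*$, let $\nu$ be the largest index with $d_\nu a_\nu^\dagger=\max_j d_ja_j^\dagger$, and let $\delta_{A^\dagger(\Gamma)}(X)=X-\frac{c^*(D,A^\dagger)}{X^\top A^{\dagger\top}A^\dagger X}A^\dagger X$. Let $\mathcal H_\Gamma=\{\theta:\theta_j^2\le\gamma_j,\ j=1,\ldots,p\}$ and $R(\delta,\mathcal H_\Gamma)=\sup_{\theta\in\mathcal H_\Gamma}E_\theta\|\delta(X)-\theta\|^2$. If $\nu=3$, then \[ R\{\delta_{A^\dagger(\Gamma)},\mathcal H_\Gamma\}\le\operatorname{tr}(D)-\sum_{j=3}^pd_j^*+\frac23d_3^*. \] If $\nu\ge4$, then \[ R\{\delta_{A^\dagger(\Gamma)},\mathcal H_\Gamma\}\le\operatorname{tr}(D)-\sum_{j=3}^pd_j^*+\Big(d_3^*+d_4^*-4\frac{d_\nu^*}{\nu}\Big)\le\operatorname{tr}(D)-\sum_{j=3}^pd_j^*+(d_3^*+d_4^*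 ). \]
   Context: The maximizer $A^\dagger$ exists and is unique. *)

(* Defs.v *)
From HB Require Import structures.
From mathcomp Require Import all_boot all_order all_algebra.
From mathcomp Require Import all_classical all_reals all_analysis.
Set Implicit Arguments. Unset Strict Implicit. Unset Printing Implicit Defensive.
Import Order.TTheory GRing.Theory Num.Theory.
Local Open Scope classical_set_scope.
Local Open Scope ring_scope.

(* Vectors in R^p are functions 'I_p -> R; diagonal matrices
   diag(v_1,...,v_p) are represented by their diagonal v : 'I_p -> R.
   Paper index j (1-based) corresponds to ordinal j-1. *)

Definition vat {R : realType} {p : nat} (v : 'I_p -> R) (j : nat) : R :=
  match @insub nat (fun k => k < p)%N _ j with Some i => v i | None => 0 end.

Definition dstar {R : realType} {p : nat} (d gam : 'I_p -> R) (j : 'I_p) : R :=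
  d j ^+ 2 / (d j + gam j).

(* max_j d_j a_j  (all terms are >= 0 in our use) *)
Definition maxda {R : realType} {p : nat} (d a : 'I_p -> R) : R :=
  \big[Num.max/0]_(j < p) (d j * a j).

Definition cstar {R : realType} {p : nat} (d a : 'I_p -> R) : R :=
  \sum_(j < p) d j * a j - 2 * maxda d a.

Definition feasible {R : realType} {p : nat} (d gam a : 'I_p -> R) : Prop :=
  (forall j, 0 <= a j) /\
  \sum_(j < p) (d j + gam j) * a j ^+ 2 = \sum_(j < p) dstar d gam j.

Definition is_maximizer {R : realType} {p : nat} (d gam a : 'I_p -> R) : Prop :=
  feasible d gam a /\ forall b, feasible d gam b -> cstar d b <= cstar d a.

Definition delta_est {R : realType} {p : nat} (d a : 'I_p -> R) (x : 'I_p -> R)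
  : 'I_p -> R :=
  fun j => x j - cstar d a / (\sum_(k < p) (a k * x k) ^+ 2) * (a j * x j).

Definition sqnorm {R : realType} {p : nat} (v : 'I_p -> R) : R :=
  \sum_(j < p) v j ^+ 2.

Definition HGamma {R : realType} {p : nat} (gam : 'I_p -> R) : set ('I_p -> R) :=
  [set theta | forall j, theta j ^+ 2 <= gam j].

(* X = (X_1,...,X_p) ~ N_p(theta, diag(d)): the joint law of X on measurable
   rectangles is the product of the normal laws N(theta_j, d_j) (variance d_j,
   i.e. standard deviation sqrt d_j).  This characterizes the law of X:
   independent coordinates with X_j ~ N(theta_j, d_j). *)
Definition gaussian_diag {R : realType} {p : nat} {dm : measure_display}
  {T : measurableType dm} (P : probability T R) (X : 'I_p -> T -> R)
  (theta d : 'I_p -> R) : Prop :=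
  (forall j, measurable_fun setT (X j)) /\
  forall B : 'I_p -> set R, (forall j, measurable (B j)) ->
    P (\bigcap_(j in [set: 'I_p]) (X j @^-1` B j)) =
    (\prod_(j < p) normal_prob (theta j) (Num.sqrt (d j)) (B j))%E.

Definition sq_loss_expect {R : realType} {p : nat} {dm : measure_display}
  {T : measurableType dm} (P : probability T R) (X : 'I_p -> T -> R)
  (delta : ('I_p -> R) -> ('I_p -> R)) (theta : 'I_p -> R) : \bar R :=
  (\int[P]_w (sqnorm (fun j => delta (fun k => X k w) j - theta j))%:E)%E.

(* Main.v *)
Require Import Defs.
From HB Require Import structures.
From mathcomp Require Import all_boot all_order all_algebra.
From mathcomp Require Import all_classical all_reals all_analysis.
From mathcomp Require Import measurable_realfun ring lra.
Import Order.TTheory GRing.Theory Num.Theory.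
Import numFieldNormedType.Exports.
Local Open Scope classical_set_scope.
Local Open Scope ring_scope.

(* With c = cstar d a, Stein's identity and Jensen's inequality bound the risk of
   delta_est d a by tr(D) - c^2 / S, where S = sum_j dstar_j.  The singularity at
   X = 0 is avoided by adding e > 0 to the denominator and letting e tend to 0 by
   Fatou's lemma; Jensen is used pointwise as 1/n >= 2/M - n/M^2.  Since X_j is
   independent of sum_{k <> j} (a_k X_k)^2, only the one-dimensional Stein
   identity and Fubini are needed.

   The constrained maximizer also maximizes, without the quadratic constraint,
   the concave function u |-> sum_j u_j - 2 max u - (c / 2S) sum_j u_j^2 / dstar_j
   of u_j = d_j a_j >= 0.  Varying one coordinate, then the top block j <= nu
   jointly, gives a threshold m <= dstar_nu with
   m * sum_{j <= nu} 1 / dstar_j = nu - 2 and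
   c^2 / S = (nu - 2) m + sum_{j > nu} dstar_j (1-based nu). *)

(** * Stein's identity for the normal law *)

Lemma fatou_le {d} {T : measurableType d} {R : realType}
    (mu : {measure set T -> \bar R}) (f_ : nat -> T -> R) (f : T -> R)
    (M_ : nat -> R) (M : R) :
  (forall n, measurable_fun setT (f_ n)) -> (forall n x, 0 <= f_ n x) ->
  (forall x, f_ n x @[n --> \oo] --> f x) ->
  (forall n, \int[mu]_x (f_ n x)%:E <= (M_ n)%:E)%E ->
  M_ n @[n --> \oo] --> M ->
  (\int[mu]_x (f x)%:E <= M%:E)%E.
Proof.
move=> mf f0 ff fM MM.
have fE x : (f x)%:E = limn_einf (fun n => (f_ n x)%:E).
  by apply/esym; apply: (cvg_limn_einf_sup _).1; apply: cvg_EFin; [exact: nearW|exact: ff].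
under eq_integral do rewrite fE.
apply: le_trans.
  apply: fatou => //.
  - by move=> n; exact/measurable_EFinP.
  - by move=> n x _; rewrite lee_fin.
have cM : (M_ n)%:E @[n --> \oo] --> M%:E by apply: cvg_EFin => //; exact: nearW.
rewrite limn_einf_lim -(cvg_lim _ cM)//.
apply: lee_lim; [exact: is_cvg_einfs|by apply/cvg_ex; exists M%:E|].
apply: nearW => n; apply: le_trans (fM n).
by apply: ereal_inf_lbound; exists n => /=.
Qed.

(** Quadratic domination: with a finite second moment it makes the integrand of Stein's identity
    integrable, on the line and on the probability space. The square [(t - 1) ^+ 2] absorbs the term
    linear in [t]. *)
Lemma stein_integrand_bound {R : realFieldType} (K v t h h' : R) : 0 <= v ->
  `|h| <= K * (1 + `|t|) -> `|h'| <= K ->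
  `|t * h - v * h'| <= K * (2 + v) * (t ^+ 2 + 1).
Proof.
move=> v0 hK h'K; have K0 : 0 <= K by exact: le_trans h'K.
rewrite (le_trans (ler_normB _ _))// normrM [X in _ + X]normrM (ger0_norm v0).
have t0 := normr_ge0 t.
have -> : t ^+ 2 = `|t| ^+ 2 by rewrite real_normK ?num_real.
move: `|t| `|h| `|h'| t0 hK h'K => {}t x y t0 xK yK.
have H1 : t * x <= t * (K * (1 + t)) by rewrite ler_wpM2l.
have H2 : v * y <= v * K by rewrite ler_wpM2l.
have H3 : 0 <= K * (t - 1) ^+ 2 by exact: mulr_ge0 (sqr_ge0 _).
have H4 : 0 <= K * v * t ^+ 2.
  by apply: mulr_ge0 (sqr_ge0 _); exact: mulr_ge0.
have H5 : 0 <= K * t ^+ 2 by exact: mulr_ge0 (sqr_ge0 _).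
nra.
Qed.

Section stein.
Context (R : realType) (m s : R).
Hypothesis s_gt0 : 0 < s.
Local Notation mu := (@lebesgue_measure R).
Local Notation N := (normal_prob m s).
Local Notation phi := (normal_pdf m s).

Lemma is_derive_normal_pdf (x : R) :
  is_derive x 1 phi (- ((x - m) / s ^+ 2) * phi x).
Proof.
have s0 : s != 0 by rewrite gt_eqF.
rewrite !normal_pdfE// /normal_fun.
apply: is_derive_eq.
rewrite /GRing.scale/=.
by field.
Qed.

Lemma integral_normal_prob (U : set R) (f : R -> R) : measurable U ->
  (normal_prob m s).-integrable U (EFin \o f) ->
  (\int[normal_prob m s]_(x in U) (f x)%:E =
   \int[mu]_(x in U) (f x * phi x)%:E)%E.
Proof.
move=> mU intf.
rewrite -(Radon_Nikodym_change_of_variables (normal_prob_dominates m s))//=.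
have mphi : measurable_fun U (fun x => (phi x)%:E).
  by apply/measurable_funTS/measurableT_comp => //; exact: measurable_normal_pdf.
under [RHS]eq_integral do rewrite EFinM.
apply: ae_eq_integral => //.
- apply: emeasurable_funM => //; first exact: measurable_int intf.
  apply: (measurable_int mu).
  apply: (integrableS _ _ (@subsetT _ _)) => //=.
  by apply: Radon_Nikodym_integrable; exact: normal_prob_dominates.
- by apply: emeasurable_funM => //=; exact: measurable_int intf.
(* The Radon-Nikodym derivative and [phi] have the same integral over every measurable set, hence
   agree almost everywhere. *)
- apply: ae_eqe_mul2l => /=.
  rewrite Radon_NikodymE//=; first exact: normal_prob_dominates.
  move=> abmu.
  case: cid => /= h [h1 h2 h3].
  apply: integral_ae_eq => //=.
  + exact: integrableS h2.
  + by move=> E _ mE; rewrite -h3.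
Qed.

Lemma integrable_normal_itv (g : R -> R) (a b : R) : continuous g ->
  (normal_prob m s).-integrable `[a, b] (fun x : R => (g x)%:E).
Proof.
move=> cg; apply: measurable_bounded_integrable => //=.
- by apply: (le_lt_trans (probability_le1 _ _)) => //; exact: ltry.
- apply: measurable_funTS; exact: continuous_measurable_fun.
- have /compact_bounded[M [_ Mg]] :=
    continuous_compact (continuous_subspaceT cg) (@segment_compact R a b).
  exists M; split; rewrite ?num_real// => y My x xab.
  by apply: Mg => //; exists x.
Qed.

(** Since [phi] has derivative [- ((x - m) / s ^+ 2) * phi], the integrand times [phi] is the
    derivative of [- s ^+ 2 * (h * phi)]; only boundary terms remain. *)
Lemma stein_interval (h h' : R -> R) (a b : R) : a < b ->
  (forall x : R, is_derive x 1 h (h' x)) -> continuous h' ->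
  (\int[N]_(x in `[a, b]) ((x - m) * h x - s ^+ 2 * h' x)%:E =
   (s ^+ 2 * (h a * phi a - h b * phi b))%:E)%E.
Proof.
move=> ab dh ch'.
have s0 : s != 0 by rewrite gt_eqF.
have ch : continuous h.
  by move=> x; apply/differentiable_continuous/derivable1_diffP.
pose g x := (x - m) * h x - s ^+ 2 * h' x.
have cg : continuous g.
  move=> x; apply: cvgB; apply: cvgM; [|exact: ch|exact: cvg_cst|exact: ch'].
  by apply: cvgB; [exact: cvg_id|exact: cvg_cst].
pose G x := - (s ^+ 2) * (h x * phi x).
have dG (x : R) : is_derive x 1 G (g x * phi x).
  have := is_derive_normal_pdf x => dphi.
  rewrite /G; apply: is_derive_eq.
  rewrite /GRing.scale/= /g; by field.
rewrite integral_normal_prob//=; last exact: integrable_normal_itv.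
rewrite (@continuous_FTC2 _ _ G)//.
- by rewrite -EFinB /G; congr EFin; ring.
- apply: continuous_subspaceT => x; apply: cvgM; first exact: cg.
  exact: continuous_normal_pdf.
- split.
  + by move=> x _.
  + apply: cvg_at_right_filter.
    by apply/differentiable_continuous/derivable1_diffP.
  + apply: cvg_at_left_filter.
    by apply/differentiable_continuous/derivable1_diffP.
- by move=> x _; rewrite derive1E; exact: derive_val.
Qed.

Lemma normal_pdf_sym (r : R) : phi (m - r) = phi (m + r).
Proof.
rewrite !normal_pdfE ?gt_eqF// /normal_fun.
by congr (_ * expR _); congr (_ / _); congr (- _); ring.
Qed.

(** Stein's identity on symmetric intervals, with [h x = x - m], bounds the truncated second moment
    by [s ^+ 2]; Fatou's lemma removes the truncation. *)
Lemma integrable_normal_sqr :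
  (normal_prob m s).-integrable setT (fun x : R => ((x - m) ^+ 2)%:E).
Proof.
have mf : measurable_fun setT (fun x : R => ((x - m) ^+ 2)%:E).
  apply/measurable_EFinP/measurable_funX.
  exact: measurable_funB.
apply/integrableP; split => //.
pose I n := `[m - n.+1%:R, m + n.+1%:R]%classic : set R.
pose f n := (fun x : R => (x - m) ^+ 2) \_ (I n).
under eq_integral do rewrite gee0_abs ?lee_fin ?sqr_ge0//.
apply: (@le_lt_trans _ _ (s ^+ 2)%:E); last exact: ltry.
apply: (@fatou_le _ _ _ (normal_prob m s) f (fun x => (x - m) ^+ 2) (cst (s ^+ 2))).
- move=> n; apply/measurable_restrict => //.
    exact: measurable_itv.
  by apply: measurable_funTS; exact/measurable_EFinP.
- by move=> n x; rewrite /f patchE; case: ifPn => // _; rewrite sqr_ge0.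
- move=> x; apply: cvg_near_cst.
  exists (Num.truncn `|x - m|) => // n /= xn.
  rewrite /f patchE mem_set// /I/= in_itv/=.
  have /ltW : `|x - m| < n.+1%:R by apply: lt_le_trans (truncnS_gt _) _; rewrite ler_nat.
  by rewrite ler_norml => /andP[? ?]; apply/andP; split; lra.
- move=> n; rewrite /f.
  rewrite -[X in (\int[_]_x X x)%E]/(EFin \o ((fun x : R => (x - m) ^+ 2) \_ (I n))).
  rewrite -restrict_EFin -integral_mkcond.
  have csub : continuous (fun x : R => x - m).
    by move=> x; apply: cvgB; [exact: cvg_id|exact: cvg_cst].
  have -> : EFin \o (fun x : R => (x - m) ^+ 2) =
    (fun x : R => ((x - m) * (x - m) - s ^+ 2 * 1)%:E + (s ^+ 2)%:E)%E.
    by apply/funext => x /=; rewrite -EFinD; congr EFin; ring.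
  rewrite integralD//=; [|exact: measurable_itv| |].
  + rewrite integral_cst; last exact: measurable_itv.
    have ltI : m - n.+1%:R < m + n.+1%:R by have := ltr0Sn R n; lra.
    have dsub (x : R) : is_derive x 1 (fun x : R => x - m) (cst 1 x).
      by apply: is_derive_eq; rewrite subr0.
    have := stein_interval _ _ _ _ ltI dsub (@cst_continuous R R 1).
    (* By symmetry of the density the boundary term is [s ^+ 2 * phi (m + n.+1%:R)] times
       [- 2 * n.+1%:R], hence nonpositive. *)
    move=> /= ->; rewrite normal_pdf_sym.
    apply: (@le_trans _ _ (0%:E + (s ^+ 2)%:E * 1)%E); last first.
      by rewrite mule1 add0e.
    apply: leeD.
      rewrite lee_fin mulr_ge0_le0 ?sqr_ge0//.
      rewrite -mulrBl mulr_le0_ge0 ?normal_pdf_ge0//.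
      have := ler0n R n.+1. lra.
    apply: lee_wpmul2l; first by rewrite lee_fin sqr_ge0.
    apply: probability_le1; exact: measurable_itv.
  + apply: (@integrable_normal_itv (fun x => (x - m) * (x - m) - s ^+ 2 * 1)).
    move=> x; apply: cvgB; last exact: cvg_cst.
    by apply: cvgM; exact: csub.
  + apply: (@integrable_normal_itv (cst (s ^+ 2))); exact: cst_continuous.
- exact: cvg_cst.
Qed.

(** The identity on [[m - t, m + t]] passes to the line by dominated convergence; the boundary terms
    vanish because [h] grows at most linearly while [phi (m + t)] is [O(1 / t^2)]. *)
Lemma stein_normal (h h' : R -> R) (K : R) :
  (forall x : R, is_derive x 1 h (h' x)) -> continuous h' ->
  (forall x, `|h x| <= K * (1 + `|x - m|)) -> (forall x, `|h' x| <= K) ->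
  (\int[normal_prob m s]_x ((x - m) * h x - s ^+ 2 * h' x)%:E = 0)%E.
Proof.
move=> dh ch' hK h'K.
have K0 : 0 <= K by apply: le_trans (h'K 0).
have ch : continuous h.
  by move=> x; apply/differentiable_continuous/derivable1_diffP.
pose g x := (x - m) * h x - s ^+ 2 * h' x.
have cg : continuous g.
  move=> x; apply: cvgB; apply: cvgM; [|exact: ch|exact: cvg_cst|exact: ch'].
  by apply: cvgB; [exact: cvg_id|exact: cvg_cst].
have mg : measurable_fun setT g by exact: continuous_measurable_fun.
pose K1 := K * (2 + s ^+ 2).
pose B (x : R) := (K1%:E * ((x - m) ^+ 2 + 1)%:E)%E.
have iB : (normal_prob m s).-integrable setT B.
  apply: integrableZl => //.
  under eq_fun do rewrite EFinD.
  apply: integrableD => //; first exact: integrable_normal_sqr.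
  exact: finite_measure_integrable_cst.
have gB x : `|g x| <= K1 * ((x - m) ^+ 2 + 1).
  exact: stein_integrand_bound (sqr_ge0 _) (hK x) (h'K x).
pose I n := `[m - n.+1%:R, m + n.+1%:R]%classic : set R.
pose f n := (fun x : R => (g x)%:E) \_ (I n).
have cv : (\int[normal_prob m s]_x f n x)%E @[n --> \oo] -->
    (\int[normal_prob m s]_x (g x)%:E)%E.
  apply: (@dominated_cvg _ _ _ (normal_prob m s) setT measurableT f
    (fun x => (g x)%:E) B) => //.
  - move=> n; apply/measurable_restrict => //; first exact: measurable_itv.
    by apply: measurable_funTS; exact/measurable_EFinP.
  - move=> x _; apply: cvg_near_cst.
    exists (Num.truncn `|x - m|) => // n /= xn.
    rewrite /f patchE mem_set// /I/= in_itv/=.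
    have /ltW : `|x - m| < n.+1%:R.
      by apply: lt_le_trans (truncnS_gt _) _; rewrite ler_nat.
    by rewrite ler_norml => /andP[? ?]; apply/andP; split; lra.
  - move=> n x _; rewrite /f patchE; case: ifPn => _.
      by rewrite /B -EFinM abse_EFin lee_fin.
    rewrite abse0 /B -EFinM lee_fin !mulr_ge0 ?addr_ge0 ?sqr_ge0//.
have cv0 : (\int[normal_prob m s]_x f n x)%E @[n --> \oo] --> (0%:E : \bar R).
  have fE n : (\int[normal_prob m s]_x f n x = (s ^+ 2 *
     (phi (m + n.+1%:R) * (h (m - n.+1%:R) - h (m + n.+1%:R))))%:E)%E.
    rewrite /f -integral_mkcond stein_interval//.
      by rewrite normal_pdf_sym; congr EFin; ring.
    by have := ltr0Sn R n; lra.
  under eq_fun do rewrite fE.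
  apply: cvg_EFin; first exact: nearW.
  (* [C] multiplies the two estimates proved below at [t = n.+1%:R]: [4 * K * t] for the difference
     of [h], and [normal_peak s * (s ^+ 2 *+ 2) / t ^+ 2] for the density. *)
  pose C := s ^+ 2 * (normal_peak s * (s ^+ 2 *+ 2) * (4 * K)).
  have cC : C * n.+1%:R^-1 @[n --> \oo] --> (0 : R).
    rewrite -(mulr0 C); apply: cvgM; first exact: cvg_cst.
    exact: cvg_harmonic.
  apply/norm_cvg0P; apply: (squeeze_cvgr _ (cvg_cst 0) cC).
  apply: nearW => n; rewrite normr_ge0/= /C normrM (ger0_norm (sqr_ge0 s)).
  rewrite -mulrA ler_wpM2l ?sqr_ge0// normrM (ger0_norm (normal_pdf_ge0 _ _ _)).
  have := hK (m - n.+1%:R); have := hK (m + n.+1%:R).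
  have t1 : (1 : R) <= n.+1%:R by rewrite ler1n.
  move: (n.+1%:R : R) t1 => t t1.
  have t0 : 0 < t by lra.
  rewrite (_ : m + t - m = t); last ring.
  rewrite (_ : m - t - m = - t); last ring.
  rewrite normrN (gtr0_norm t0) => h1 h2.
  have h3 : `|h (m - t) - h (m + t)| <= 4 * K * t.
    rewrite (le_trans (ler_normB _ _))//.
    have : K * (1 + t) <= K * (2 * t) by rewrite ler_wpM2l//; lra.
    lra.
  have y0 : 0 < t ^+ 2 / (s ^+ 2 *+ 2).
    by rewrite divr_gt0 ?exprn_gt0// pmulrn_lgt0 ?exprn_gt0.
  have h4 : phi (m + t) <= normal_peak s * (s ^+ 2 *+ 2) / t ^+ 2.
    rewrite normal_pdfE ?gt_eqF// /normal_fun -mulrA.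
    rewrite ler_wpM2l ?normal_peak_ge0//.
    rewrite (_ : m + t - m = t); last ring.
    (* The decay [expR (- y) <= 1 / y] follows from [1 + y <= expR y]. *)
    rewrite mulNr expRN -[leRHS]invf_div lef_pV2 ?posrE ?expR_gt0//.
    by apply: le_trans (expR_ge1Dx _); rewrite lerDr.
  apply: (le_trans (ler_pM (normal_pdf_ge0 _ _ _) (normr_ge0 _) h4 h3)).
  by rewrite le_eqVlt; apply/orP; left; apply/eqP; field; rewrite gt_eqF.
exact: (cvg_unique _ cv cv0).
Qed.

End stein.

(** * Independent coordinates *)

Section independence.
Context {R : realType} {p : nat} {dm : measure_display} {T : measurableType dm}.
Variables (P : probability T R) (X : 'I_p -> T -> R).
Variable Q : 'I_p -> probability (measurableTypeR R) R.
Hypothesis mX : forall j, measurable_fun setT (X j).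
Hypothesis PX : forall B : 'I_p -> set R, (forall j, measurable (B j)) ->
  P (\bigcap_(j in [set: 'I_p]) (X j @^-1` B j)) = (\prod_(j < p) Q j (B j))%E.

(** Rectangles with slot [j] left free: a pi-system generating the sigma-algebra of the coordinates
    other than [X j], so independence from [X j] can be tested on it. *)
Definition others_rect (j : 'I_p) : set (set T) :=
  [set E | exists2 B : 'I_p -> set R, (forall k, measurable (B k)) /\ B j = setT &
     E = \bigcap_(k in [set: 'I_p]) (X k @^-1` B k)].

Lemma measurable_others_rect j : others_rect j `<=` measurable.
Proof.
move=> E [B [mB _] ->]; apply: fin_bigcap_measurable => // k _.
by rewrite -[X in measurable X]setTI; exact: mX.
Qed.

Lemma others_rectT j : others_rect j setT.
Proof. by exists (fun _ => setT) => //; apply/seteqP; split => // x _ k _ //. Qed.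

(** For fixed [A] both sides are finite measures in [E]; they agree on the pi-system
    [others_rect j], hence on the sigma-algebra it generates. *)
Lemma others_rect_indep j (A : set R) (E : set T) : measurable A ->
  <<s others_rect j >> E -> P (X j @^-1` A `&` E) = (Q j A * P E)%E.
Proof.
move=> mA sE.
have mXA : measurable (X j @^-1` A).
  by rewrite -[X in measurable X]setTI; exact: mX.
have QA0 : 0 <= fine (Q j A) by rewrite fine_ge0.
have GT := others_rectT j.
have mE F : mscale (NngNum QA0) P F = (Q j A * P F)%E.
  by rewrite /mscale/= fineK// fin_num_measure.
rewrite setIC -mE.
apply: (g_sigma_algebra_measure_unique (others_rect j) _ (cst setT)
  _ _ (mrestr P mXA) (mscale (NngNum QA0) P)) sE => //.
- exact: measurable_others_rect.
- by rewrite bigcup_const//; exists 0%N.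
- move=> _ _ [B [mB Bj] ->] [C [mC Cj] ->].
  exists (fun k => B k `&` C k).
    by split; [move=> k; exact: measurableI|rewrite Bj Cj setIT].
  by rewrite -bigcapI; apply: eq_bigcapr => k _; rewrite preimage_setI.
- move=> _ [B [mB Bj] ->].
  transitivity (Q j A * P (\bigcap_(k in [set: 'I_p]) (X k @^-1` B k)))%E; last first.
    exact/esym/mE.
  rewrite (PX B)// /mrestr.
  (* Slot [j] of [B] is free, so intersecting with the event that [X j] lies in [A] gives the
     rectangle [C], to which the product formula applies. *)
  pose C k := if k == j then A else B k.
  have mC k : measurable (C k) by rewrite /C; case: ifP.
  transitivity (P (\bigcap_(k in [set: 'I_p]) (X k @^-1` C k))).
    congr (P _); apply/seteqP; split.
      by move=> x [/= xB xA] k _; rewrite /C/=; case: eqP => [->//|_]; exact: xB.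
    move=> x xC; split => [k _|] /=.
      by have := xC k I; rewrite /C/=; case: eqP => // ->; rewrite Bj.
    by have := xC j I; rewrite /C/= eqxx.
  rewrite (PX C)// (bigD1 j)//= [in RHS](bigD1 j)//= Bj /C eqxx probability_setT mul1e.
  by congr (_ * _)%E; apply: eq_bigr => k /negbTE ->.
- move=> k; apply: le_lt_trans (ltry 1).
  exact: probability_le1 (measurableI _ _ measurableT mXA).
Qed.
End independence.

(** The joint law of [X] and [Y] is the product of [Q] and the law of [Y], by uniqueness on
    rectangles; integrating in [x] first gives 0 for each [y]. *)
Lemma fubini_indep_eq0 {R : realType} {dm : measure_display}
    {T : measurableType dm} (P : probability T R)
    (Q : probability (measurableTypeR R) R) (X Y : T -> R) (f : R -> R -> R) :
  measurable_fun setT X -> measurable_fun setT Y ->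
  measurable_fun setT (fun z : measurableTypeR R * R => f z.1 z.2) ->
  (forall A B : set R, measurable A -> measurable B ->
    P (X @^-1` A `&` Y @^-1` B) = (Q A * P (Y @^-1` B))%E) ->
  P.-integrable setT (fun w => (f (X w) (Y w))%:E) ->
  (forall y, \int[Q]_x (f x y)%:E = 0)%E ->
  (\int[P]_w (f (X w) (Y w))%:E = 0)%E.
Proof.
move=> mX mY mf indep intf f0.
pose XY w : measurableTypeR R * R := (X w, Y w).
have mXY : measurable_fun setT XY by exact/measurable_fun_pairP.
pose Ym : {mfun T >-> R} := HB.pack Y (isMeasurableFun.Build _ _ _ _ Y mY).
pose muY := distribution P Ym.
pose F (z : measurableTypeR R * R) := (f z.1 z.2)%:E.
have mF : measurable_fun setT F by exact/measurable_EFinP.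
have EXY A : measurable A -> (Q \x muY)%E A = pushforward P XY A.
  move=> mA; apply: (@product_measure_unique _ _ _ _ _ Q muY (pushforward P XY)) => //.
transitivity (\int[pushforward P XY]_z F z)%E.
  by rewrite integral_pushforward.
rewrite (eq_measure_integral (Q \x muY)%E); last by move=> A mA _; exact/esym/EXY.
rewrite -fubini2.
  by rewrite /fubini_G integral0_eq// => y _; exact: f0.
have /integrableP[_ ltF] : (pushforward P XY).-integrable setT F.
  exact: integrable_pushforward.
apply/integrableP; split => //; move: ltF; apply: le_lt_trans.
by rewrite (eq_measure_integral (pushforward P XY))// => A mA _; exact: EXY.
Qed.

(** * Risk bound *)

(** Integrability is included so that these functions are closed under linear combinations. *)
Definition mean_zero {R : realType} {dm : measure_display} {T : measurableType dm}
    (P : probability T R) (f : T -> R) : Prop :=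
  P.-integrable setT (fun w => (f w)%:E) /\ (\int[P]_w (f w)%:E = 0)%E.

Section mean_zero.
Context {R : realType} {dm : measure_display} {T : measurableType dm}.
Variable P : probability T R.

Lemma mean_zeroZ k f : mean_zero P f -> mean_zero P (fun w => k * f w).
Proof.
move=> [intf f0]; split.
  by under eq_fun do rewrite EFinM; exact: integrableZl.
by under eq_integral do rewrite EFinM; rewrite integralZl// f0 mule0.
Qed.

Lemma mean_zeroD f g : mean_zero P f -> mean_zero P g ->
  mean_zero P (fun w => f w + g w).
Proof.
move=> [intf f0] [intg g0]; split.
  by under eq_fun do rewrite EFinD; exact: integrableD.
by under eq_integral do rewrite EFinD; rewrite integralD// f0 g0 adde0.
Qed.

Lemma mean_zero_sum (I : Type) (s : seq I) (f : I -> T -> R) :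
  (forall i, mean_zero P (f i)) -> mean_zero P (fun w => \sum_(i <- s) f i w).
Proof.
move=> mf; elim: s => [|i s IH].
  under eq_fun do rewrite big_nil.
  by split; [exact: integrable0|rewrite integral0].
by under eq_fun do rewrite big_cons; exact: mean_zeroD.
Qed.

Lemma integrable_comp_law (Q : probability (measurableTypeR R) R)
    (X : T -> R) (f : R -> R) :
  measurable_fun setT X ->
  (forall A : set R, measurable A -> P (X @^-1` A) = Q A) ->
  Q.-integrable setT (fun x : R => (f x)%:E) ->
  P.-integrable setT (fun w => (f (X w))%:E).
Proof.
move=> mX PX /integrableP[mf intf].
have mfX : measurable_fun setT (fun w => (f (X w))%:E).
  exact: (measurableT_comp mf mX).
apply/integrableP; split => //; move: intf; apply: le_lt_trans.
pose X' : T -> measurableTypeR R := X.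
have mX' : measurable_fun setT X' by exact: mX.
rewrite (eq_measure_integral (pushforward P X')); last first.
  by move=> A mA _; rewrite /= -PX.
rewrite ge0_integral_pushforward//; exact: measurableT_comp.
Qed.

(** Reduces a risk bound to a pointwise inequality, with all the random terms of the upper bound
    collected in [g]. *)
Lemma integral_le_of_mean_zero (f g : T -> R) (M : R) :
  measurable_fun setT f -> (forall w, 0 <= f w) ->
  mean_zero P g -> (forall w, f w <= g w + M) ->
  (\int[P]_w (f w)%:E <= M%:E)%E.
Proof.
move=> mf f0 [intg g0] fg.
have intM : P.-integrable setT (fun _ => M%:E).
  exact: finite_measure_integrable_cst.
have mg : measurable_fun setT (fun w => (g w)%:E) by exact: measurable_int intg.
apply: (@le_trans _ _ (\int[P]_w ((g w)%:E + M%:E))%E).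
  apply: ge0_le_integral => //.
  - by move=> w _; rewrite lee_fin.
  - exact/measurable_EFinP.
  - exact: emeasurable_funD.
  - by move=> w _; rewrite -EFinD lee_fin.
rewrite integralD// g0 add0e integral_cst//.
by rewrite [X in (_ * X)%E]probability_setT mule1.
Qed.
End mean_zero.

(** Where [f >= e], inversion coincides with the continuous map [z |-> 1 / max(e, z)]. *)
Lemma measurable_funV_ge {R : realType} {dm : measure_display}
    {T : measurableType dm} (e : R) (f : T -> R) : 0 < e ->
  (forall w, e <= f w) -> measurable_fun setT f ->
  measurable_fun setT (fun w => (f w)^-1).
Proof.
move=> e0 ef mf.
pose iv z : R := (Num.max e z)^-1.
have civ : continuous iv.
  move=> z; apply: cvgV; first by rewrite gt_eqF// lt_max e0.
  by apply: continuous_max; [exact: cvg_cst|exact: cvg_id].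
under eq_fun => w.
  rewrite -(max_r (ef w)) -/(iv _).
  over.
exact: (measurableT_comp (continuous_measurable_fun civ) mf).
Qed.

(** * The smoothed shrinkage factor as a function of one coordinate *)

Section shrink.
Context {R : realType}.
Variables (al e : R).
Hypotheses (al_ge0 : 0 <= al) (e_gt0 : 0 < e).

(** With [al = a_j^2], [x = X_j] and [y] the sum of [(a_k X_k)^2] over [k <> j], this is the
    smoothed denominator of the estimator. The absolute value keeps it at least [e] for every real
    [y]. *)
Definition shrink_den (y x : R) : R := al * x ^+ 2 + `|y| + e.

Lemma shrink_den_ge y x : e <= shrink_den y x.
Proof. by rewrite /shrink_den lerDr addr_ge0// mulr_ge0// sqr_ge0. Qed.

Lemma shrink_den_gt0 y x : 0 < shrink_den y x.
Proof. exact: lt_le_trans (shrink_den_ge y x). Qed.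

Definition shrink (y x : R) : R := x / shrink_den y x.

Definition shrink' (y x : R) : R :=
  (`|y| + e - al * x ^+ 2) / shrink_den y x ^+ 2.

Lemma is_derive_shrink (y x : R) : is_derive x 1 (shrink y) (shrink' y x).
Proof.
have n0 : shrink_den y x != 0 by rewrite gt_eqF ?shrink_den_gt0.
have dn : is_derive x 1 (shrink_den y) (2 * al * x).
  by rewrite /shrink_den; apply: is_derive_eq; rewrite /GRing.scale/=; ring.
rewrite /shrink; apply: is_derive_eq.
have yE : `|y| + e = shrink_den y x - al * x ^+ 2 by rewrite /shrink_den; ring.
by rewrite /shrink' yE /GRing.scale/=; field.
Qed.

Lemma continuous_shrink' y : continuous (shrink' y).
Proof.
have cx : continuous (fun x : R => al * x ^+ 2).
  by move=> x; apply: cvgM; [exact: cvg_cst|exact: exprn_continuous].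
have cn : continuous (shrink_den y).
  by move=> x; apply: cvgD; [apply: cvgD; [exact: cx|exact: cvg_cst]|exact: cvg_cst].
move=> x; apply: cvgM; first by apply: cvgB; [exact: cvg_cst|exact: cx].
apply: cvgV; first by rewrite expf_neq0// gt_eqF ?shrink_den_gt0.
by apply: (cvg_comp _ (fun z : R => z ^+ 2) (cn x)); exact: exprn_continuous.
Qed.

Lemma measurable_shrink_den :
  measurable_fun setT (fun z : measurableTypeR R * R => shrink_den z.2 z.1).
Proof.
apply: measurable_funD => //; apply: measurable_funD.
  apply: measurable_funM => //; apply: measurable_funX; exact: measurable_fst.
by apply: measurableT_comp => //; exact: measurable_snd.
Qed.

Lemma measurable_shrink_den_inv :
  measurable_fun setT (fun z : measurableTypeR R * R => (shrink_den z.2 z.1)^-1).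
Proof.
apply: (measurable_funV_ge e) => // [z|]; last exact: measurable_shrink_den.
exact: shrink_den_ge.
Qed.

Lemma measurable_shrink :
  measurable_fun setT (fun z : measurableTypeR R * R => shrink z.2 z.1).
Proof.
apply: measurable_funM; first exact: measurable_fst.
exact: measurable_shrink_den_inv.
Qed.

Lemma measurable_shrink' :
  measurable_fun setT (fun z : measurableTypeR R * R => shrink' z.2 z.1).
Proof.
apply: measurable_funM.
  apply: measurable_funB.
    apply: measurable_funD => //; exact: measurableT_comp.
  apply: measurable_funM => //; apply: measurable_funX; exact: measurable_fst.
under eq_fun do rewrite -exprVn.
by apply: measurable_funX; exact: measurable_shrink_den_inv.
Qed.

(** The constant is the same as in [shrink'_bound], because [stein_normal] takes one [K] for the
    function and its derivative. *)
Lemma shrink_bound (m y x : R) :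
  `|shrink y x| <= (1 + `|m|) / e * (1 + `|x - m|).
Proof.
have n0 := shrink_den_gt0 y x.
rewrite /shrink normrM normfV (gtr0_norm n0).
apply: (@le_trans _ _ (`|x| / e)).
  by rewrite ler_wpM2l// lef_pV2 ?posrE// shrink_den_ge.
rewrite mulrAC ler_wpM2r ?invr_ge0 ?(ltW e_gt0)//.
have H : `|x| <= `|x - m| + `|m| by rewrite -{1}(subrK m x) ler_normD.
have H1 : 0 <= `|m| * `|x - m| by rewrite mulr_ge0.
have H2 := normr_ge0 m.
rewrite mulrDl mul1r mulrDr mulr1; lra.
Qed.

Lemma shrink'_bound (m y x : R) : `|shrink' y x| <= (1 + `|m|) / e.
Proof.
have n0 := shrink_den_gt0 y x.
rewrite /shrink' normrM normfV (gtr0_norm (exprn_gt0 2 n0)).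
apply: (@le_trans _ _ (shrink_den y x / shrink_den y x ^+ 2)).
  rewrite ler_wpM2r ?invr_ge0 ?exprn_ge0 ?(ltW n0)// ler_norml /shrink_den.
  have y0 : 0 <= `|y| := normr_ge0 y.
  have x0 : 0 <= al * x ^+ 2 by rewrite mulr_ge0 ?sqr_ge0.
  move: e_gt0 y0 x0; move: (al * x ^+ 2) `|y| e => u v w w0 v0 u0.
  apply/andP; split; lra.
rewrite expr2 invfM mulrA divff ?gt_eqF// mul1r.
apply: (@le_trans _ _ e^-1).
  by rewrite lef_pV2 ?posrE// shrink_den_ge.
by rewrite ler_peMl ?invr_ge0 ?(ltW e_gt0)// lerDl.
Qed.
End shrink.

(** * Mean-zero terms and risk under the Gaussian law *)

Section gaussian.
Context {R : realType} {p : nat} {dm : measure_display} {T : measurableType dm}.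
Variables (P : probability T R) (X : 'I_p -> T -> R) (theta d : 'I_p -> R).
Hypothesis d_gt0 : forall j, 0 < d j.
Hypothesis gX : gaussian_diag P X theta d.

Local Notation sig j := (Num.sqrt (d j)).
Let Q (j : 'I_p) : probability (measurableTypeR R) R := normal_prob (theta j) (sig j).

Let mX j : measurable_fun setT (X j). Proof. by case: gX. Qed.

Let PX (B : 'I_p -> set R) : (forall j, measurable (B j)) ->
  P (\bigcap_(j in [set: 'I_p]) (X j @^-1` B j)) = (\prod_(j < p) Q j (B j))%E.
Proof. by case: gX => _; apply. Qed.

Let marginal j (A : set R) : measurable A -> P (X j @^-1` A) = Q j A.
Proof.
move=> mA.
have sT : <<s others_rect X j >> setT by apply: sub_sigma_algebra; exact: others_rectT.
have := others_rect_indep _ _ _ mX PX j A setT mA sT.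
by rewrite setIT probability_setT mule1.
Qed.

Let sig_gt0 j : 0 < sig j. Proof. by rewrite sqrtr_gt0. Qed.

Let sigE j : sig j ^+ 2 = d j. Proof. by rewrite sqr_sqrtr// ltW. Qed.

Lemma integrable_gaussian_sqr j : P.-integrable setT (fun w => ((X j w - theta j) ^+ 2)%:E).
Proof.
apply: (integrable_comp_law P (Q j) (X j) (fun x => (x - theta j) ^+ 2)) => //.
- exact: marginal.
- by apply: integrable_normal_sqr; exact: sig_gt0.
Qed.

Lemma measurable_others_X j k : k != j ->
  measurable_fun (setT : set (g_sigma_algebraType (others_rect X j))) (X k).
Proof.
move=> kj _ A mA; rewrite setTI; apply: sub_sigma_algebra.
exists (fun i => if i == k then A else setT).
  split; last by rewrite eq_sym (negbTE kj).
  by move=> i; case: ifP.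
apply/seteqP; split => [x xA i _|x /(_ k I)]; last by rewrite eqxx.
by rewrite /=; case: eqP => // ->.
Qed.

(** [Y] depends only on the coordinates other than [j], so it can be frozen: the one-dimensional
    identity holds for each value [y], and independence allows integrating over [y]. *)
Lemma stein_indep j (Y : T -> R) (h h' : R -> R -> R) (K : R) :
  measurable_fun (setT : set (g_sigma_algebraType (others_rect X j))) Y ->
  measurable_fun setT (fun z : measurableTypeR R * R => h z.2 z.1) ->
  measurable_fun setT (fun z : measurableTypeR R * R => h' z.2 z.1) ->
  (forall y x : R, is_derive x 1 (h y) (h' y x)) ->
  (forall y, continuous (h' y)) ->
  (forall y x, `|h y x| <= K * (1 + `|x - theta j|)) ->
  (forall y x, `|h' y x| <= K) ->
  mean_zero P (fun w => (X j w - theta j) * h (Y w) (X j w) - d j * h' (Y w) (X j w)).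
Proof.
move=> mY mh mh' dh ch' hK h'K.
pose g x y := (x - theta j) * h y x - d j * h' y x.
have mYT : measurable_fun setT Y.
  move=> _ A mA; have := mY measurableT A mA.
  apply: smallest_sub; last exact: measurable_others_rect.
  exact: sigma_algebra_measurable.
have mg : measurable_fun setT (fun z : measurableTypeR R * R => g z.1 z.2).
  apply: measurable_funB; apply: measurable_funM => //.
  by apply: measurable_funB => //; exact: measurable_fst.
have intg : P.-integrable setT (fun w => (g (X j w) (Y w))%:E).
  pose K1 := K * (2 + d j).
  have iB : P.-integrable setT (fun w => K1%:E * ((X j w - theta j) ^+ 2 + 1)%:E)%E.
    apply: integrableZl => //; under eq_fun do rewrite EFinD.
    apply: integrableD => //; first exact: integrable_gaussian_sqr.
    exact: finite_measure_integrable_cst.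
  apply: (le_integrable _ _ _ iB) => //.
    apply/measurable_EFinP.
    exact: (measurableT_comp mg (measurable_fun_pair (mX j) mYT)).
  move=> w _; rewrite -EFinM !abse_EFin lee_fin.
  apply: le_trans (ler_norm _).
  exact: stein_integrand_bound (ltW (d_gt0 j)) (hK _ _) (h'K _ _).
split => //.
apply: (fubini_indep_eq0 P (Q j) (X j) Y g) => //.
  move=> A B mA mB; apply: (others_rect_indep _ _ _ mX PX) => //.
  by have := mY measurableT B mB; rewrite setTI.
move=> y; rewrite /g -sigE.
exact: (stein_normal R (theta j) (sig j) (sig_gt0 j) (h y) (h' y) K
  (dh y) (ch' y) (hK y) (h'K y)).
Qed.

Lemma mean_zero_X j : mean_zero P (fun w => X j w - theta j).
Proof.
have := stein_indep j (cst 0) (fun _ => cst 1) (fun _ => cst 0) 1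
  (measurable_cst _) (measurable_cst _) (measurable_cst _).
under [X in _ -> _ -> _ -> _ -> mean_zero P X]eq_fun do rewrite /= mulr1 mulr0 subr0.
apply.
- by move=> _; exact: cst_continuous.
- by move=> _ x; rewrite /= normr1 mul1r lerDl.
- by move=> _ x; rewrite /= normr0.
Qed.

Lemma mean_zero_sqr j : mean_zero P (fun w => (X j w - theta j) ^+ 2 - d j).
Proof.
have := stein_indep j (cst 0) (fun _ x => x - theta j) (fun _ => cst 1) 1
  (measurable_cst _) _ (measurable_cst _).
under [X in _ -> _ -> _ -> _ -> _ -> mean_zero P X]eq_fun do rewrite /= mulr1 -expr2.
apply.
- by apply: measurable_funB => //; exact: measurable_fst.
- by move=> _ x; apply: is_derive_eq; rewrite subr0.
- by move=> _; exact: cst_continuous.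
- by move=> _ x; rewrite mul1r lerDr.
- by move=> _ x; rewrite /= normr1.
Qed.

Definition others_sqr (a : 'I_p -> R) j w := \sum_(k < p | k != j) (a k * X k w) ^+ 2.

Lemma mean_zero_shrink (a : 'I_p -> R) (e : R) j : 0 < e ->
  mean_zero P (fun w =>
    (X j w - theta j) * shrink (a j ^+ 2) e (others_sqr a j w) (X j w) -
    d j * shrink' (a j ^+ 2) e (others_sqr a j w) (X j w)).
Proof.
move=> e0; have a0 := sqr_ge0 (a j).
apply: (stein_indep j (others_sqr a j) _ _ ((1 + `|theta j|) / e)).
- rewrite /others_sqr; under eq_fun do rewrite big_mkcond/=.
  apply: measurable_sum => k; case: (eqVneq k j) => [_|kj] //=.
  by apply: measurable_funX; apply: measurable_funM => //; exact: measurable_others_X.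
- exact: measurable_shrink.
- exact: measurable_shrink'.
- exact: is_derive_shrink.
- exact: continuous_shrink'.
- by move=> y x; exact: shrink_bound.
- by move=> y x; exact: shrink'_bound.
Qed.

(** The loss is bounded pointwise by a mean-zero function plus the claimed constant: expand the
    square, trade each cross term for a derivative through Stein's identity, then replace the
    remaining [- c ^+ 2 / n] by a function affine in [n]. *)
Lemma risk_smoothed (a : 'I_p -> R) (c t S e : R) :
  (forall j, d j * a j <= t) -> 0 <= t -> 0 <= c ->
  \sum_(j < p) d j * a j - 2 * t = c ->
  \sum_(j < p) (d j + theta j ^+ 2) * a j ^+ 2 <= S -> 0 < e ->
  (\int[P]_w (\sum_(j < p) (X j w - c / (\sum_(k < p) (a k * X k w) ^+ 2 + e)
      * (a j * X j w) - theta j) ^+ 2)%:E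
    <= (\sum_(j < p) d j - c ^+ 2 / (S + e))%:E)%E.
Proof.
move=> dat t0 c0 ct aS e0.
have S0 : 0 <= S.
  apply: le_trans aS; apply: sumr_ge0 => j _.
  by rewrite mulr_ge0 ?sqr_ge0// addr_ge0 ?sqr_ge0// ltW.
pose M := S + e.
have M0 : 0 < M by rewrite ltr_wpDl.
(* The slope of [n |-> - c ^+ 2 / n] at [n = M]. *)
pose q : R := c ^+ 2 / M ^+ 2.
pose V j w := (X j w - theta j) ^+ 2 - d j.
pose L j w := X j w - theta j.
pose h j w := shrink (a j ^+ 2) e (others_sqr a j w) (X j w).
pose h' j w := shrink' (a j ^+ 2) e (others_sqr a j w) (X j w).
pose Z j w := (X j w - theta j) * h j w - d j * h' j w.
(* The terms carrying [q] add up to [q] times the centred sum of the [(a_j X_j)^2], whose mean is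
   [\sum_j (d j + theta j ^+ 2) * a j ^+ 2]. *)
pose G w := \sum_(j < p) ((1 + q * a j ^+ 2) * V j w + (- (2 * c * a j) * Z j w
   + 2 * q * a j ^+ 2 * theta j * L j w)).
apply: (integral_le_of_mean_zero P _ G).
- apply: measurable_sum => j; apply: measurable_funX.
  apply: measurable_funB => //; apply: measurable_funB => //.
  apply: measurable_funM; last exact: measurable_funM.
  apply: measurable_funM => //; apply: (measurable_funV_ge e) => //.
    by move=> w; rewrite lerDr; apply: sumr_ge0 => k _; exact: sqr_ge0.
  apply: measurable_funD => //; apply: measurable_sum => k.
  by apply: measurable_funX; exact: measurable_funM.
- by move=> w; apply: sumr_ge0 => j _; exact: sqr_ge0.
- apply: mean_zero_sum => j; apply: mean_zeroD.
    by apply: mean_zeroZ; exact: mean_zero_sqr.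
  apply: mean_zeroD; apply: mean_zeroZ; last exact: mean_zero_X.
  exact: mean_zero_shrink.
move=> w.
pose N := \sum_(k < p) (a k * X k w) ^+ 2.
pose n := N + e.
have N0 : 0 <= N by apply: sumr_ge0 => k _; exact: sqr_ge0.
have n0 : 0 < n by rewrite ltr_wpDl.
have denE j : shrink_den (a j ^+ 2) e (others_sqr a j w) (X j w) = n.
  rewrite /shrink_den ger0_norm; last by apply: sumr_ge0 => k _; exact: sqr_ge0.
  by rewrite /n /N (bigD1 j)//= -exprMn.
have hE j : h j w = X j w / n by rewrite /h /shrink denE.
have h'E j : h' j w = n^-1 - 2 * a j ^+ 2 * X j w ^+ 2 / n ^+ 2.
  have yE : `|others_sqr a j w| + e = n - a j ^+ 2 * X j w ^+ 2.
    by rewrite -(denE j) /shrink_den; ring.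
  by rewrite /h' /shrink' denE yE; field; rewrite gt_eqF.
have nE : N = \sum_(j < p) a j ^+ 2 * (V j w + d j + 2 * theta j * L j w + theta j ^+ 2).
  by apply: eq_bigr => j _; rewrite /V /L; ring.
(* Differentiating the denominator costs at most [2 * t / n], because each [d j * a j <= t]. This is
   the origin of the [- 2 max] term of [cstar]. *)
have key : c / n <= \sum_(j < p) d j * a j * h' j w.
  have -> : \sum_(j < p) d j * a j * h' j w = (c + 2 * t) / n -
      2 / n ^+ 2 * \sum_(j < p) d j * a j * (a j * X j w) ^+ 2.
    rewrite -ct subrK mulr_suml mulr_sumr -sumrB; apply: eq_bigr => j _.
    by rewrite h'E; field; rewrite gt_eqF.
  have tN : \sum_(j < p) d j * a j * (a j * X j w) ^+ 2 <= t * n.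
    apply: (@le_trans _ _ (t * N)); last by rewrite ler_wpM2l// lerDl ltW.
    by rewrite mulr_sumr; apply: ler_sum => j _; rewrite ler_wpM2r// sqr_ge0.
  have : 2 / n ^+ 2 * \sum_(j < p) d j * a j * (a j * X j w) ^+ 2 <=
      2 / n ^+ 2 * (t * n).
    by rewrite ler_wpM2l// divr_ge0// exprn_ge0// ltW.
  have -> : 2 / n ^+ 2 * (t * n) = 2 * t / n by field; rewrite gt_eqF.
  rewrite (mulrDl c (2 * t)); lra.
rewrite -/N -/n.
have -> : \sum_(j < p) (X j w - c / n * (a j * X j w) - theta j) ^+ 2 =
    \sum_(j < p) (V j w - 2 * c * a j * Z j w) + \sum_(j < p) d j
    - 2 * c * (\sum_(j < p) d j * a j * h' j w) + c ^+ 2 * N / n ^+ 2.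
  have -> : c ^+ 2 * N / n ^+ 2 = \sum_(j < p) c ^+ 2 / n ^+ 2 * (a j * X j w) ^+ 2.
    by rewrite -mulr_sumr -/N mulrAC.
  rewrite mulr_sumr -big_split -sumrB -big_split/=; apply: eq_bigr => j _.
  by rewrite /Z hE /V; field; rewrite gt_eqF.
have -> : G w = \sum_(j < p) (V j w - 2 * c * a j * Z j w) +
    q * (N - \sum_(j < p) (d j + theta j ^+ 2) * a j ^+ 2).
  rewrite nE -sumrB mulr_sumr -big_split/=; apply: eq_bigr => j _; ring.
have H1 : 2 * c * (c / n) <= 2 * c * (\sum_(j < p) d j * a j * h' j w).
  by rewrite ler_wpM2l// mulr_ge0.
have q0 : 0 <= q by rewrite divr_ge0 ?sqr_ge0.
have H2 : q * (N - S) <= q * (N - \sum_(j < p) (d j + theta j ^+ 2) * a j ^+ 2).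
  by rewrite ler_wpM2l// lerB.
have H3 : c ^+ 2 * N / n ^+ 2 <= c ^+ 2 / n.
  have -> : c ^+ 2 / n = c ^+ 2 * n / n ^+ 2 by field; rewrite gt_eqF.
  by rewrite ler_wpM2r ?invr_ge0 ?sqr_ge0// ler_wpM2l ?sqr_ge0// lerDl ltW.
(* This square is exactly the gap between [- c ^+ 2 / n] and its tangent at [n = M]. *)
have H4 : 0 <= c ^+ 2 / n * (1 - n / M) ^+ 2.
  by rewrite mulr_ge0 ?sqr_ge0// divr_ge0 ?sqr_ge0// ltW.
have H5 : c ^+ 2 / n * (1 - n / M) ^+ 2 = c ^+ 2 / n - c ^+ 2 / M + q * (N - S).
  rewrite /q (_ : N - S = n - M); last by rewrite /n /M; ring.
  by field; rewrite !gt_eqF.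
rewrite -/M.
have H6 : 2 * c * (c / n) = 2 * (c ^+ 2 / n) by ring.
lra.
Qed.

(** The smoothing is removed along [e k = 1 / (k + 1)], with [t = maxda d a]: the smoothed losses
    converge pointwise and so do their bounds. *)
Lemma risk_bound (a : 'I_p -> R) (S : R) :
  0 <= cstar d a -> 0 < S ->
  \sum_(j < p) (d j + theta j ^+ 2) * a j ^+ 2 <= S ->
  (sq_loss_expect P X (delta_est d a) theta
    <= (\sum_(j < p) d j - cstar d a ^+ 2 / S)%:E)%E.
Proof.
move=> c0 S0 aS.
pose e k : R := k.+1%:R^-1.
have e0 k : 0 < e k by rewrite invr_gt0.
have ce : e k @[k --> \oo] --> (0 : R) by exact: cvg_harmonic.
pose N w := \sum_(k < p) (a k * X k w) ^+ 2.
have N0 w : 0 <= N w by apply: sumr_ge0 => k _; exact: sqr_ge0.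
pose f_ n w := \sum_(j < p)
  (X j w - cstar d a / (N w + e n) * (a j * X j w) - theta j) ^+ 2.
rewrite /sq_loss_expect /sqnorm /delta_est.
apply: (fatou_le P f_ _ (fun n => \sum_(j < p) d j - cstar d a ^+ 2 / (S + e n))).
- move=> n; apply: measurable_sum => j; apply: measurable_funX.
  apply: measurable_funB => //; apply: measurable_funB => //.
  apply: measurable_funM; last exact: measurable_funM.
  apply: measurable_funM => //; apply: (measurable_funV_ge (e n)) => //.
    by move=> w; rewrite lerDr.
  apply: measurable_funD => //; apply: measurable_sum => k.
  by apply: measurable_funX; exact: measurable_funM.
- by move=> n w; apply: sumr_ge0 => j _; exact: sqr_ge0.
- move=> w; rewrite /f_.
  have cvj j : cstar d a / (N w + e n) * (a j * X j w) @[n --> \oo] -->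
      cstar d a / N w * (a j * X j w).
    (* at [N w = 0] every [a j * X j w] vanishes, matching the junk value [x / 0 = 0] *)
    have [Nw0|Nw0] := eqVneq (N w) 0.
      have : (a j * X j w) ^+ 2 = 0.
        apply/eqP; move: Nw0 => /eqP; rewrite psumr_eq0; last by move=> k _; exact: sqr_ge0.
        by move=> /allP/(_ j (mem_index_enum _))/=.
      move=> /eqP; rewrite sqrf_eq0 => /eqP ->.
      by rewrite mulr0; under eq_fun do rewrite mulr0; exact: cvg_cst.
    apply: cvgM; last exact: cvg_cst.
    apply: cvgM; first exact: cvg_cst.
    apply: cvgV => //; rewrite -[X in _ --> X]addr0.
    by apply: cvgD => //; exact: cvg_cst.
  apply: cvg_big => [x0|j _]; first exact: add_continuous.
  apply: (cvg_comp _ (fun z : R => z ^+ 2)); last exact: exprn_continuous.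
  apply: cvgB; last exact: cvg_cst.
  by apply: cvgB; [exact: cvg_cst|exact: cvj].
- move=> n; apply: (risk_smoothed a (cstar d a) (maxda d a)) => //.
  + by move=> j; exact: le_bigmax.
  + exact: bigmax_ge_id.
- apply: cvgB; first exact: cvg_cst.
  apply: cvgM; first exact: cvg_cst.
  apply: cvgV; first by rewrite gt_eqF.
  by rewrite -[X in _ --> X]addr0; apply: cvgD => //; exact: cvg_cst.
Qed.

End gaussian.

(** * The maximizer *)

Lemma sum1_ord_lt {R : nzRingType} (p k : nat) : (k <= p)%N ->
  \sum_(j < p | (j < k)%N) (1 : R) = k%:R.
Proof.
move=> kp; rewrite -(big_ord_widen _ (fun=> 1))//.
by rewrite sumr_const card_ord.
Qed.

(** One-sided first-order condition: at a maximum over [[x, y]] attained at the left end, the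
    derivative [al - 2 * ka * x] cannot be positive. *)
Lemma quad_right {R : realFieldType} (al ka x y : R) : 0 < ka -> x < y ->
  (forall s, x <= s <= y -> al * s - ka * s ^+ 2 <= al * x - ka * x ^+ 2) ->
  al <= 2 * ka * x.
Proof.
move=> ka0 xy H; rewrite leNgt; apply/negP => lt.
(* A step of size [de] stays in the interval and loses at most half of the slope to the quadratic
   term, so it would strictly increase the value. *)
pose de := Num.min (y - x) ((al - 2 * ka * x) / (2 * ka)).
have de0 : 0 < de.
  by rewrite lt_min subr_gt0 xy/= divr_gt0 ?subr_gt0// mulr_gt0.
have de1 : de <= y - x by rewrite ge_min lexx.
have de2 : ka * de <= (al - 2 * ka * x) / 2.
  have : ka * de <= ka * ((al - 2 * ka * x) / (2 * ka)).
    by rewrite ler_pM2l// ge_min lexx orbT.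
  by congr (_ <= _); field; rewrite gt_eqF.
have := H (x + de).
have -> : x <= x + de <= y by apply/andP; split; lra.
move=> /(_ isT) H1.
have H2 : de * (al - 2 * ka * x - ka * de) <= 0 by lra.
have : 0 < de * (al - 2 * ka * x - ka * de) by rewrite mulr_gt0//; lra.
lra.
Qed.

Lemma quad_left {R : realFieldType} (al ka x y : R) : 0 < ka -> y < x ->
  (forall s, y <= s <= x -> al * s - ka * s ^+ 2 <= al * x - ka * x ^+ 2) ->
  2 * ka * x <= al.
Proof.
move=> ka0 yx H.
rewrite -lerN2 -mulrN; apply: (quad_right _ _ _ (- y)) => //.
  by rewrite ltrN2.
move=> s /andP[s1 s2]; have := H (- s).
rewrite lerNr s2 lerNl s1 => /(_ isT).
by rewrite !sqrrN !mulrN !mulNr opprK.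
Qed.

Section maximizer.
Context {R : realType} {p : nat}.
Variables (e u : 'I_p -> R) (nu : 'I_p).
Local Notation t := (\big[Num.max/0]_(j < p) u j).
Local Notation S := (\sum_(j < p) e j).
Local Notation c := (\sum_(j < p) u j - 2 * t).
Hypothesis p3 : (3 <= p)%N.
Hypothesis e0 : forall j, 0 < e j.
Hypothesis e_noninc : forall i j : 'I_p, (i <= j)%N -> e j <= e i.
Hypothesis u0 : forall j, 0 <= u j.
Hypothesis uS : \sum_(j < p) u j ^+ 2 / e j = S.
Hypothesis umax : forall b : 'I_p -> R, (forall j, 0 <= b j) ->
  \sum_(j < p) b j ^+ 2 / e j = S ->
  \sum_(j < p) b j - 2 * \big[Num.max/0]_(j < p) b j <= c.
Hypothesis unu : u nu = t.
Hypothesis unu_last : forall j : 'I_p, (nu < j)%N -> u j <> t.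

Let S_gt0 : 0 < S.
Proof.
rewrite (bigD1 nu)//= ltr_pwDl// sumr_ge0// => j _; exact/ltW.
Qed.

Let ut j : u j <= t. Proof. exact: le_bigmax. Qed.

Let t0 : 0 <= t. Proof. exact: bigmax_ge_id. Qed.

(** A constant vector [s], scaled to be feasible, has value at least [(p - 2) * s], positive since
    [p >= 3]. *)
Lemma max_value_gt0 : 0 < c.
Proof.
pose E := \sum_(j < p) (e j)^-1.
have E0 : 0 < E.
  rewrite /E (bigD1 nu)//= ltr_pwDl ?invr_gt0// sumr_ge0// => j _.
  by rewrite invr_ge0 ltW.
pose s := Num.sqrt (S / E).
have s0 : 0 < s by rewrite sqrtr_gt0 divr_gt0.
have := umax (fun _ => s) (fun _ => ltW s0).
rewrite -mulr_sumr -/E sqr_sqrtr; last by rewrite divr_ge0 ?ltW.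
rewrite divfK ?gt_eqF// => /(_ erefl); apply: lt_le_trans.
rewrite sumr_const card_ord.
have H : \big[Num.max/0]_(j < p) s <= s by apply: bigmax_le => //; exact: ltW.
have : s * 3 <= s *+ p by rewrite -[leRHS]mulr_natr ler_pM2l// ler_nat.
lra.
Qed.

Local Notation la := (c / S).

Let la0 : 0 < la. Proof. by rewrite divr_gt0// max_value_gt0. Qed.

(** The objective has degree 1 and the constraint degree 2, so rescaling turns the constraint into a
    penalty with multiplier [la / 2]; [u] attains the bound [c / 2]. Any upper bound [r] may stand
    for the maximum of [b], which eases the choice of test vectors. *)
Lemma penalized_max (b : 'I_p -> R) (r : R) : (forall j, 0 <= b j <= r) -> 0 <= r ->
  \sum_(j < p) b j - 2 * r - la / 2 * \sum_(j < p) b j ^+ 2 / e j <= c / 2.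
Proof.
move=> b0r r0.
have b0 j : 0 <= b j by case/andP: (b0r j).
have c0 := max_value_gt0.
pose B := \sum_(j < p) b j ^+ 2 / e j.
have B0j j : 0 <= b j ^+ 2 / e j by rewrite divr_ge0 ?sqr_ge0// ltW.
have B0 : 0 <= B by apply: sumr_ge0.
rewrite -/B.
have [Bz|Bn0] := eqVneq B 0.
  have bz j : b j = 0.
    have : b j ^+ 2 / e j == 0.
      by move: Bz => /eqP; rewrite psumr_eq0// => /allP/(_ j (mem_index_enum _)).
    by rewrite mulf_eq0 invr_eq0 (gt_eqF (e0 j)) orbF sqrf_eq0 => /eqP.
  rewrite Bz mulr0 subr0 big1; last by move=> j _; exact: bz.
  lra.
have Bp : 0 < B by rewrite lt_neqAle eq_sym Bn0.
(* [b / k] is feasible; then AM-GM: [k <= (k ^+ 2 + 1) / 2] *)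
pose k := Num.sqrt (B / S).
have k0 : 0 < k by rewrite sqrtr_gt0 divr_gt0.
have kE : k ^+ 2 = B / S by rewrite sqr_sqrtr// divr_ge0 ?ltW.
have := umax (fun j => k^-1 * b j).
have -> : \sum_(j < p) (k^-1 * b j) ^+ 2 / e j = S.
  under eq_bigr do rewrite exprMn -mulrA.
  by rewrite -mulr_sumr -/B exprVn kE; field; rewrite !gt_eqF.
have kb j : 0 <= k^-1 * b j by rewrite mulr_ge0 ?invr_ge0// ltW.
move=> /(_ kb erefl); rewrite -mulr_sumr => H.
have H1 : \big[Num.max/0]_(j < p) (k^-1 * b j) <= k^-1 * r.
  apply: bigmax_le; first by rewrite mulr_ge0 ?invr_ge0// ltW.
  by move=> j _; rewrite ler_wpM2l ?invr_ge0 ?(ltW k0)//; case/andP: (b0r j).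
have H2 : k^-1 * (\sum_(j < p) b j - 2 * r) <= c by lra.
have H3 : \sum_(j < p) b j - 2 * r <= k * c.
  by rewrite -ler_pdivrMl.
have H4 : la / 2 * B = c / 2 * k ^+ 2 by rewrite kE; ring.
have H5 : 0 <= c / 2 * (k - 1) ^+ 2.
  by apply: mulr_ge0 (sqr_ge0 _); apply: divr_ge0 => //; exact: ltW.
rewrite H4; lra.
Qed.

Lemma penalized_max_u (b : 'I_p -> R) (r : R) : (forall j, 0 <= b j <= r) -> 0 <= r ->
  \sum_(j < p) b j - 2 * r - la / 2 * \sum_(j < p) b j ^+ 2 / e j <=
  \sum_(j < p) u j - 2 * t - la / 2 * \sum_(j < p) u j ^+ 2 / e j.
Proof.
move=> b0r r0; apply: le_trans (penalized_max b r b0r r0) _.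
by rewrite uS mulrAC divfK ?gt_eqF//; lra.
Qed.

(** The test vector equals [s] on [A] and [u] elsewhere; the coordinates outside [A] cancel. *)
Lemma block_max (A : pred 'I_p) (s r : R) : 0 <= r ->
  (forall j, 0 <= (if A j then s else u j) <= r) ->
  \sum_(j < p | A j) s - 2 * r - la / 2 * \sum_(j < p | A j) s ^+ 2 / e j <=
  \sum_(j < p | A j) u j - 2 * t - la / 2 * \sum_(j < p | A j) u j ^+ 2 / e j.
Proof.
move=> r0 H; have := penalized_max_u _ r H r0.
have split (f : 'I_p -> R) : \sum_(j < p) f j =
    \sum_(j < p | A j) f j + \sum_(j < p | ~~ A j) f j by rewrite (bigID A).
rewrite !split.
rewrite (eq_bigr (fun _ => s)); last by move=> i ->.
rewrite [X in _ + X - _ - _](eq_bigr u); last by move=> i /negbTE ->.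
rewrite [X in _ * (X + _)](eq_bigr (fun i => s ^+ 2 / e i)); last by move=> i ->.
rewrite [X in _ * (_ + X)](eq_bigr (fun i => u i ^+ 2 / e i)); last first.
  by move=> i /negbTE ->.
rewrite !mulrDr; lra.
Qed.

Lemma coordinate_max j s : 0 <= s <= t ->
  s - la / 2 / e j * s ^+ 2 <= u j - la / 2 / e j * u j ^+ 2.
Proof.
move=> s0t.
have H i : 0 <= (if i == j then s else u i) <= t by case: ifP => // _; rewrite u0 ut.
have := block_max (pred1 j) s t t0 H; rewrite !big_pred1_eq => H1.
have E x : la / 2 / e j * x = la / 2 * (x / e j) by ring.
rewrite !E; lra.
Qed.

Let la_e j : 0 < la / 2 / e j.
Proof. by rewrite divr_gt0// divr_gt0. Qed.

Let t_gt0 : 0 < t.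
Proof.
rewrite lt_neqAle t0 andbT eq_sym; apply/eqP => tz.
have := max_value_gt0; rewrite tz mulr0 subr0 big1 ?ltxx// => j _.
by apply/eqP; rewrite eq_le u0 -{1}tz ut.
Qed.

(** Lowering a single coordinate keeps it below [t], so its derivative from the left is nonnegative.
    In [stationary_eq] the coordinate can also be raised, which gives equality. *)
Lemma stationary_le j : la * u j <= e j.
Proof.
have [->|uj] := eqVneq (u j) 0; first by rewrite mulr0 ltW.
have uj0 : 0 < u j by rewrite lt_neqAle eq_sym uj u0.
have : 2 * (la / 2 / e j) * u j <= 1.
  apply: (quad_left _ _ _ 0) => // s /andP[s1 s2].
  by rewrite !mul1r; apply: coordinate_max; rewrite s1/= (le_trans s2).
rewrite (_ : _ * u j = la * u j / e j); last by field; rewrite !gt_eqF.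
by rewrite ler_pdivrMr// mul1r.
Qed.

Lemma stationary_eq j : u j < t -> la * u j = e j.
Proof.
move=> ujt; apply/eqP; rewrite eq_le stationary_le/=.
have : 1 <= 2 * (la / 2 / e j) * u j.
  apply: (quad_right _ _ _ t) => // s /andP[s1 s2].
  by rewrite !mul1r; apply: coordinate_max; rewrite s2 andbT (le_trans (u0 j)).
rewrite (_ : _ * u j = la * u j / e j); last by field; rewrite !gt_eqF.
by rewrite ler_pdivlMr// mul1r.
Qed.

(** If [u j < t] then [la * u j = e j >= e nu >= la * u nu = la * t], a contradiction. *)
Lemma block_top (j : 'I_p) : (j <= nu)%N -> u j = t.
Proof.
move=> jnu; apply/eqP; rewrite eq_le ut/= leNgt; apply/negP => /[dup] ujt.
move=> /stationary_eq laj.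
have : la * t <= la * u j.
  by rewrite laj (le_trans _ (e_noninc _ _ jnu))// -[X in _ * X]unu stationary_le.
by rewrite ler_pM2l// leNgt ujt.
Qed.

Lemma block_below (j : 'I_p) : (nu < j)%N -> u j < t.
Proof. by move=> nuj; rewrite lt_neqAle ut andbT; apply/eqP; exact: unu_last. Qed.

(** Moving the whole top block to a common level [s] changes the linear part at rate [nu.+1 - 2]:
    one unit per coordinate, minus 2 for the maximum. The level can move both ways, so the
    derivative at [t] vanishes. *)
Lemma block_stationary :
  la * t * \sum_(j < p | (j <= nu)%N) (e j)^-1 = nu.+1%:R - 2.
Proof.
pose E := \sum_(j < p | (j <= nu)%N) (e j)^-1.
have E0 : 0 < E.
  rewrite /E (bigD1 nu)//= ltr_pwDl ?invr_gt0// sumr_ge0// => j _.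
  by rewrite invr_ge0 ltW.
(* The block may be lowered down to [lo], the largest value outside it (0 if there is none), while
   [s] still bounds every coordinate. *)
pose lo := \big[Num.max/0]_(j < p | (nu < j)%N) u j.
have lo_t : lo < t by apply: bigmax_lt => // j; exact: block_below.
have lo0 : 0 <= lo by exact: bigmax_ge_id.
have ka0 : 0 < la / 2 * E by rewrite mulr_gt0// divr_gt0.
have H s : lo <= s -> (nu.+1%:R - 2) * s - la / 2 * E * s ^+ 2 <=
    (nu.+1%:R - 2) * t - la / 2 * E * t ^+ 2.
  move=> los; have s0 : 0 <= s by exact: le_trans los.
  have Hs (j : 'I_p) : 0 <= (if (j <= nu)%N then s else u j) <= s.
    case: ifPn => [_|]; first by rewrite s0 lexx.
    rewrite -ltnNge => nuj; rewrite u0 (le_trans _ los)//.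
    exact: le_bigmax_cond.
  have sumA x : \sum_(j < p | (j <= nu)%N) x = nu.+1%:R * x :> R.
    rewrite -(sum1_ord_lt p nu.+1) ?ltn_ord// mulr_suml.
    by apply: eq_bigr => j _; rewrite mul1r.
  have := block_max (fun j : 'I_p => (j <= nu)%N) s s s0 Hs.
  rewrite -mulr_sumr sumA.
  rewrite [X in _ <= X - _ - _](eq_bigr (fun _ => t)); last exact: block_top.
  rewrite sumA [X in _ <= _ - _ * X](eq_bigr (fun j => t ^+ 2 * (e j)^-1)); last first.
    by move=> j /block_top ->.
  rewrite -mulr_sumr -/E; lra.
have -> : la * t * \sum_(j < p | (j <= nu)%N) (e j)^-1 = 2 * (la / 2 * E) * t.
  by rewrite /E; field; rewrite gt_eqF.
apply/eqP; rewrite eq_le; apply/andP; split.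
  by apply: (quad_left _ _ _ lo) => // s /andP[s1 _]; exact: H.
apply: (quad_right _ _ _ (t + 1)) => //; first by rewrite ltrDl.
by move=> s /andP[s1 _]; apply: H; rewrite (le_trans (ltW lo_t)).
Qed.

(** The left side is [la * c], and [la * u j] equals [la * t] on the block and [e j] after it. *)
Lemma max_value_eq : c ^+ 2 / S =
  (nu.+1%:R - 2) * (la * t) + \sum_(j < p | (nu < j)%N) e j.
Proof.
have -> : c ^+ 2 / S = la * c by rewrite expr2; ring.
rewrite mulrBr mulr_sumr (bigID (fun j : 'I_p => (j <= nu)%N))/=.
rewrite [X in X + _ - _](eq_bigr (fun _ => la * t * 1)); last first.
  by move=> j /block_top ->; rewrite mulr1.
rewrite -mulr_sumr (sum1_ord_lt p nu.+1) ?ltn_ord//.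
rewrite (eq_bigl (fun j : 'I_p => (nu < j)%N)); last by move=> j; rewrite -ltnNge.
rewrite [X in _ + X - _](eq_bigr e); last first.
  by move=> j /block_below /stationary_eq.
by ring.
Qed.

Lemma maximizer_threshold : exists m : R, [/\ 0 < m, m <= e nu,
  m * \sum_(j < p | (j <= nu)%N) (e j)^-1 = nu.+1%:R - 2 &
  c ^+ 2 / S = (nu.+1%:R - 2) * m + \sum_(j < p | (nu < j)%N) e j].
Proof.
exists (la * t); split; [exact: mulr_gt0| |exact: block_stationary|exact: max_value_eq].
by rewrite -[X in _ * X]unu stationary_le.
Qed.
End maximizer.

(** * Explicit bounds deduced from the threshold equation *)

Section threshold_bounds.
Context {R : realType} {p : nat}.
Variables (e : 'I_p -> R) (nu : 'I_p) (m : R).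
Hypothesis e0 : forall j, 0 < e j.
Hypothesis e_noninc : forall i j : 'I_p, (i <= j)%N -> e j <= e i.
Hypothesis m_gt0 : 0 < m.
Hypothesis m_le : m <= e nu.
Hypothesis mE : m * \sum_(j < p | (j <= nu)%N) (e j)^-1 = nu.+1%:R - 2.

(** The right side of [mE] is 1, and each of its three reciprocals is at most [1 / e nu]. *)
Lemma threshold_bound3 : nu.+1 = 3%N -> e nu / 3 <= m.
Proof.
move=> n3.
have : \sum_(j < p | (j <= nu)%N) (e j)^-1 <= 3 / e nu.
  rewrite -n3 -(sum1_ord_lt p nu.+1) ?ltn_ord// mulr_suml.
  by apply: ler_sum => j jnu; rewrite mul1r lef_pV2 ?posrE// e_noninc.
rewrite -(ler_pM2l m_gt0) mE n3 => H.
have : (3 - 2) * e nu <= m * (3 / e nu) * e nu by rewrite ler_pM2r.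
rewrite -mulrA divfK ?gt_eqF//; lra.
Qed.

(* [w j = (1 - 2/n) mu_j + 2/n], where the multipliers [mu_j = 1 - m / e j] sum
   to 2; these weights lie in [0, 1] and have total [4 - 4/n], which is why the
   four largest [e j] appear. *)
Lemma threshold_bound4 : (4 <= nu.+1)%N ->
  \sum_(j < p | (j <= nu)%N) e j - (nu.+1%:R - 2) * m <=
  \sum_(j < p | (j < 4)%N) e j - 4 * (e nu / nu.+1%:R).
Proof.
move=> n4; pose n : R := nu.+1%:R.
have n4' : 4 <= n by rewrite ler_nat.
have n0 : 0 < n by lra.
have p4 : (4 <= p)%N by exact: leq_trans n4 (ltn_ord nu).
pose i3 : 'I_p := Ordinal p4.
pose w j := (1 - 2 / n) * (1 - m / e j) + 2 / n.
have sum1 : \sum_(j < p | (j <= nu)%N) 1 = n :> R by rewrite (sum1_ord_lt p nu.+1).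
have m_le_j (j : 'I_p) : (j <= nu)%N -> m <= e j.
  by move=> jnu; apply: le_trans m_le _; exact: e_noninc.
have sumw : \sum_(j < p | (j <= nu)%N) w j = 4 - 4 / n.
  rewrite big_split/= -mulr_sumr sumrB -mulr_sumr mE sum1.
  under [X in _ + X]eq_bigr do rewrite -[2 / n]mulr1.
  by rewrite -mulr_sumr sum1 -/n; field; rewrite gt_eqF.
have sumwe : \sum_(j < p | (j <= nu)%N) w j * e j =
    \sum_(j < p | (j <= nu)%N) e j - (n - 2) * m.
  rewrite (eq_bigr (fun j => e j - (1 - 2 / n) * m * 1)); last first.
    by move=> j _; rewrite /w; field; rewrite !gt_eqF.
  by rewrite sumrB -mulr_sumr sum1; congr (_ - _); field; rewrite gt_eqF.
have w01 (j : 'I_p) : (j <= nu)%N -> 0 <= w j <= 1.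
  move=> jnu; have n2 : 2 / n <= 2^-1 by rewrite ler_pdivrMr//; lra.
  have n20 : 0 < 2 / n by rewrite divr_gt0.
  have me0 : 0 < m / e j by rewrite divr_gt0.
  have me1 : m / e j <= 1 by rewrite ler_pdivrMr// mul1r m_le_j.
  rewrite /w; move: (2 / n) (m / e j) n2 n20 me0 me1 => x y x1 x0 y0 y1.
  have : 0 <= (1 - x) * (1 - y) by apply: mulr_ge0; lra.
  have : 0 <= (1 - x) * y by apply: mulr_ge0; lra.
  by move=> ? ?; apply/andP; split; lra.
rewrite -sumwe.
(* Compare with the fourth value [e i3]: an index before it exceeds [w j * e i3] by at most
   [e j - e i3] since [w j <= 1], and a later index does not exceed it. *)
have : \sum_(j < p | (j <= nu)%N) w j * e j <=
    \sum_(j < p | (j <= nu)%N) (w j * e i3 + (if (j < 4)%N then e j - e i3 else 0)).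
  apply: ler_sum => j jnu; have /andP[w0 w1] := w01 j jnu.
  case: ifPn => [j4|].
    have : e i3 <= e j by apply: e_noninc.
    move: (w j) (e j) (e i3) w0 w1 => x y z x0 x1 zy.
    have : 0 <= (1 - x) * (y - z) by apply: mulr_ge0; lra.
    lra.
  rewrite -leqNgt => j4; rewrite addr0 ler_wpM2l// e_noninc//.
  exact: leq_trans j4.
rewrite big_split/= -mulr_suml sumw -big_mkcondr/=.
rewrite [X in _ <= _ + X](eq_bigl (fun j : 'I_p => (j < 4)%N)); last first.
  move=> j /=; case: (ltnP j 4) => [j4|]; rewrite ?andbT ?andbF//.
  by rewrite -ltnS (leq_trans j4 n4).
rewrite sumrB [X in _ <= _ + (_ - X)](eq_bigr (fun _ => e i3 * 1)); last first.
  by move=> *; rewrite mulr1.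
rewrite -mulr_sumr sum1_ord_lt//.
(* The total weight falls short of 4 by [4 / n]; this deficit, weighted by [e i3 >= e nu], is the
   subtracted term. *)
have : e nu / n <= e i3 / n by rewrite ler_pM2r ?invr_gt0// e_noninc.
rewrite -/n (_ : (4 - 4 / n) * e i3 = 4 * e i3 - 4 * (e i3 / n)); last by ring.
move: (e nu / n) (e i3 / n) => x y; lra.
Qed.
End threshold_bounds.

(** * Return to the original parameters and conclusion *)

Lemma vatE {R : realType} {p : nat} (v : 'I_p -> R) (i : 'I_p) : vat v i = v i.
Proof.
by rewrite /vat insubT//= => ip; congr v; apply/val_inj.
Qed.

(** The substitution [u j = d j * a j] turns [(d j + gam j) * a j ^+ 2] into
    [u j ^+ 2 / dstar d gam j], the form treated in the maximizer section. *)
Lemma maximizer_kkt {R : realType} {p : nat} (d gam a : 'I_p -> R) (nu : 'I_p) :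
  (3 <= p)%N -> (forall j, 0 < d j) -> (forall j, 0 <= gam j) ->
  (forall i j : 'I_p, (i <= j)%N -> dstar d gam j <= dstar d gam i) ->
  is_maximizer d gam a -> d nu * a nu = maxda d a ->
  (forall j : 'I_p, (nu < j)%N -> d j * a j <> maxda d a) ->
  0 < cstar d a /\
  exists m : R, [/\ 0 < m, m <= dstar d gam nu,
    m * \sum_(j < p | (j <= nu)%N) (dstar d gam j)^-1 = nu.+1%:R - 2 &
    cstar d a ^+ 2 / \sum_(j < p) dstar d gam j =
      (nu.+1%:R - 2) * m + \sum_(j < p | (nu < j)%N) dstar d gam j].
Proof.
move=> p3 d0 g0 dec [[a0 aS] amax] nuE nulast.
have dg0 j : 0 < d j + gam j by rewrite ltr_pwDl.
have e0 j : 0 < dstar d gam j by rewrite divr_gt0// exprn_gt0.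
pose u j := d j * a j.
have u0 j : 0 <= u j by rewrite mulr_ge0// ltW.
have uS : \sum_(j < p) u j ^+ 2 / dstar d gam j = \sum_(j < p) dstar d gam j.
  rewrite -aS; apply: eq_bigr => j _; rewrite /u /dstar.
  by field; rewrite !gt_eqF.
have umax b : (forall j, 0 <= b j) ->
    \sum_(j < p) b j ^+ 2 / dstar d gam j = \sum_(j < p) dstar d gam j ->
    \sum_(j < p) b j - 2 * \big[Num.max/0]_(j < p) b j <= cstar d a.
  move=> b0 bS.
  have dbE j : d j * (b j / d j) = b j by rewrite mulrCA divff ?mulr1// gt_eqF.
  have := amax (fun j => b j / d j).
  rewrite /cstar /maxda; under eq_bigr do rewrite dbE.
  under [X in 2 * X]eq_bigr do rewrite dbE.
  apply; split; first by move=> j; rewrite divr_ge0// ltW.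
  rewrite -bS; apply: eq_bigr => j _; rewrite /dstar.
  by field; rewrite !gt_eqF.
split; first exact: (max_value_gt0 _ u nu p3 e0).
exact: (maximizer_threshold _ u nu p3 e0 dec u0 uS umax nuE nulast).
Qed.

(* R(delta, H_Gamma) <= b  is stated as: for every theta in H_Gamma and every
   X ~ N_p(theta, D) (on any probability space), E||delta(X)-theta||^2 <= b. *)
Theorem theorem4 (R : realType) (p : nat) (d gam a : 'I_p -> R) (nu : 'I_p) :
  (3 <= p)%N ->
  (forall j, 0 < d j) ->
  (forall j, 0 <= gam j) ->
  (forall i j : 'I_p, (i <= j)%N -> dstar d gam j <= dstar d gam i) ->
  is_maximizer d gam a ->
  d nu * a nu = maxda d a ->
  (forall j : 'I_p, (nu < j)%N -> d j * a j <> maxda d a) ->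
  let base := \sum_(j < p) d j - \sum_(j < p | (2 <= j)%N) dstar d gam j in
  let ds := vat (dstar d gam) in
  (nu.+1 = 3%N ->
    forall (theta : 'I_p -> R), HGamma gam theta ->
    forall (dm : measure_display) (T : measurableType dm) (P : probability T R)
      (X : 'I_p -> T -> R), gaussian_diag P X theta d ->
    (sq_loss_expect P X (delta_est d a) theta <=
       (base + 2 / 3 * ds 2%N)%:E)%E) /\
  ((4 <= nu.+1)%N ->
    forall (theta : 'I_p -> R), HGamma gam theta ->
    forall (dm : measure_display) (T : measurableType dm) (P : probability T R)
      (X : 'I_p -> T -> R), gaussian_diag P X theta d ->
    (sq_loss_expect P X (delta_est d a) theta <=
       (base + (ds 2%N + ds 3%N - 4 * (dstar d gam nu / (nu.+1)%:R)))%:E)%E /\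
    base + (ds 2%N + ds 3%N - 4 * (dstar d gam nu / (nu.+1)%:R))
      <= base + (ds 2%N + ds 3%N)).
Proof.
move=> p3 d0 g0 dec amax nuE nulast base ds.
have [c0 [m [m0 m_le mE cE]]] := maximizer_kkt d gam a nu p3 d0 g0 dec amax nuE nulast.
have e0 j : 0 < dstar d gam j by rewrite divr_gt0 ?exprn_gt0// ltr_pwDl.
have [[a0 aS] _] := amax.
set S := \sum_(j < p) dstar d gam j in cE.
have S0 : 0 < S by rewrite /S (bigD1 nu)//= ltr_pwDl// sumr_ge0// => j _; exact/ltW.
have risk theta : HGamma gam theta ->
    forall (dm : measure_display) (T : measurableType dm) (P : probability T R)
      (X : 'I_p -> T -> R), gaussian_diag P X theta d ->
    (sq_loss_expect P X (delta_est d a) theta <=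
      (\sum_(j < p) d j - cstar d a ^+ 2 / S)%:E)%E.
  move=> Hth dm T P X gX.
  apply: (risk_bound P X theta d d0 gX a S (ltW c0) S0).
  (* Since [theta j ^+ 2 <= gam j], the quadratic constraint on [a] bounds the mean of the
     denominator by [S] uniformly over [HGamma gam]. *)
  rewrite /S -aS; apply: ler_sum => j _.
  by rewrite ler_wpM2r ?sqr_ge0// lerD2l.
have SE : S = \sum_(j < p | (j <= nu)%N) dstar d gam j +
    \sum_(j < p | (nu < j)%N) dstar d gam j.
  rewrite /S (bigID (fun j : 'I_p => (j <= nu)%N))/=; congr (_ + _).
  by apply: eq_bigl => j; rewrite -ltnNge.
have S4 : S = \sum_(j < p | (j < 4)%N) dstar d gam j +
    \sum_(j < p | (4 <= j)%N) dstar d gam j.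
  rewrite /S (bigID (fun j : 'I_p => (j < 4)%N))/=; congr (_ + _).
  by apply: eq_bigl => j; rewrite -leqNgt.
have tail2 (i2 : 'I_p) : i2 = 2%N :> nat ->
    \sum_(j < p | (2 <= j)%N) dstar d gam j =
    ds 2%N + \sum_(j < p | (3 <= j)%N) dstar d gam j.
  move=> i2E; rewrite (bigD1 i2)/= ?i2E// -[in ds 2%N]i2E /ds vatE; congr (_ + _).
  by apply: eq_bigl => j; rewrite -val_eqE/= i2E; case: (ltngtP 2%N j).
split=> nun theta Hth dm T P X gX.
  have nu2 : nu = 2%N :> nat by case: nun.
  apply: le_trans (risk theta Hth dm T P X gX) _; rewrite lee_fin.
  (* The risk bound subtracts [m] where [base] subtracts [dstar d gam nu]; [m] being at least a
     third of it, the excess is at most two thirds. *)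
  have := threshold_bound3 _ nu m e0 dec m0 mE nun.
  have -> : base = \sum_(j < p) d j -
      (dstar d gam nu + \sum_(j < p | (nu < j)%N) dstar d gam j).
    by rewrite /base (tail2 nu nu2) /ds -{1}nu2 vatE nu2.
  have -> : ds 2%N = dstar d gam nu by rewrite -(vatE _ nu) nu2.
  rewrite cE nun; lra.
have i3p : (3 < p)%N by exact: leq_trans nun (ltn_ord nu).
pose i3 : 'I_p := Ordinal i3p.
pose i2 : 'I_p := Ordinal (ltnW i3p).
have ds2 : ds 2%N = dstar d gam i2 by rewrite -(vatE _ i2).
have ds3 : ds 3%N = dstar d gam i3 by rewrite -(vatE _ i3).
split.
  apply: le_trans (risk theta Hth dm T P X gX) _; rewrite lee_fin.
  have := threshold_bound4 _ nu m e0 dec m0 m_le mE nun.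
  (* Adding [ds 2%N + ds 3%N] to [base] leaves the trace minus the tail from the fifth value on,
     which is what the sum over [j < 4] in [threshold_bound4] matches. *)
  have -> : base = \sum_(j < p) d j - ds 2%N - ds 3%N -
      (S - \sum_(j < p | (j < 4)%N) dstar d gam j).
    rewrite /base (tail2 i2 erefl) [X in _ - (_ + X)](bigD1 i3)//= -ds3.
    rewrite [X in _ - (_ + (_ + X))](eq_bigl (fun j : 'I_p => (4 <= j)%N)).
      by rewrite S4; ring.
    by move=> j; rewrite -val_eqE/=; case: (ltngtP 3%N j).
  rewrite cE SE; move: (dstar d gam nu / _) ((_ - 2) * m) => x y; lra.
by rewrite lerD2l lerBlDr lerDl mulr_ge0// divr_ge0// ltW.
Qed.
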